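(* Let $\mathbb{F}$ be a field, $G$ a finite group, and $N\unlhd G$ a normal subgroup. Suppose that $I\subseteq\mathbb{F}[N]$ is a linear subspace and $J\subseteq\mathbb{F}[N]$ is a characteristic right ideal. Then the slice rank over $\mathbb{F}$ of the multiplication tensor of $\mathbb{F}[G]$ satisfies $$\operatorname{slice-rank}(\mathbb{F}[G])\le |G/N|\,\bigl(\operatorname{codim}_{\mathbb{F}[N]} I+\operatorname{codim}_{\mathbb{F}[N]} J+\dim IJ\bigr).$$
   Context: A subset $J$ of a ring $R$ is characteristic if $\alpha(J)=J$ for all $\alpha\in\operatorname{Aut}(R)$. $IJ$ denotes the linear span of all products $xy$ with $x\in I$, $y\in J$. For finite sets $X,Y,Z$ and a field $\mathbb{F}$, the slice rank of $F\colon X\times Y\times Z\to\mathbb{F}$ is the smallest $r$ such that, for some $0\le a\le b\le r$ and some functions $f_i,g_i$ with values in $\mathbb{F}$, $F(x,y,z)=\sum_{i=1}^a f_i(x,y)g_i(z)+\sum_{i=a+1}^b f_i(x,z)g_i(y)+\sum_{i=b+1}^r f_i(y,z)g_i(x)$. The multiplication tensor of $\mathbb{F}[G]$, in the basis of group elements, is $M_G(x,y,z)=1$ if $xy=z$ and $0$ otherwise; $\operatorname{slice-rank}(\mathbb{F}[G])$ means the slice rank of this tensor. *)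

(* Defs.v *)
From HB Require Import structures.
From mathcomp Require Import all_boot all_order all_fingroup all_algebra all_field.
From mathcomp Require Import boolp.

Set Implicit Arguments.
Unset Strict Implicit.
Unset Printing Implicit Defensive.

Import GRing.Theory.
Local Open Scope ring_scope.

(* The group algebra F[gT]: the element f stands for the formal sum of the
   f x * x over x : gT. An alias rather than a bare {ffun _ -> _}, which is
   already a ring for the pointwise product. *)
Definition galg (F : fieldType) (gT : finGroupType) : Type := {ffun gT -> F^o}.

Section GroupAlgebra.
Variables (F : fieldType) (gT : finGroupType).
Local Notation A := (galg F gT).
Implicit Types (f g h : A) (x y z : gT).

HB.instance Definition _ := Vector.copy A {ffun gT -> F^o}.

Definition galg_fun f : gT -> F := f.

Definition galg_elt x : A := [ffun y => (y == x)%:R : F^o].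

Definition galg_mul f g : A :=
  [ffun z => \sum_x galg_fun f x * galg_fun g (x^-1 * z)%g : F^o].

Lemma galgP f g : (forall x, galg_fun f x = galg_fun g x) <-> f = g.
Proof. by split=> [fg|-> //]; apply/ffunP. Qed.

Lemma galg_eltE x y : galg_fun (galg_elt x) y = (y == x)%:R.
Proof. by rewrite /galg_fun ffunE. Qed.

Lemma galg_mulE f g z :
  galg_fun (galg_mul f g) z = \sum_x galg_fun f x * galg_fun g (x^-1 * z)%g.
Proof. by rewrite /galg_fun ffunE. Qed.

Lemma galg_addE f g x : galg_fun (f + g) x = galg_fun f x + galg_fun g x.
Proof. by rewrite /galg_fun ffunE. Qed.

Lemma galg_scaleE a f x : galg_fun (a *: f) x = a * galg_fun f x.
Proof. by rewrite /galg_fun ffunE. Qed.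

Fact galg_mulA : associative galg_mul.
Proof.
move=> f g h; apply/galgP => z; rewrite !galg_mulE.
under eq_bigr => x _ do rewrite galg_mulE mulr_sumr.
under [RHS]eq_bigr => x _ do rewrite galg_mulE mulr_suml.
rewrite [RHS]exchange_big; apply: eq_bigr => x _ /=.
rewrite [RHS](reindex_inj (mulgI x)); apply: eq_bigr => y _ /=.
by rewrite mulrA mulKg invMg mulgA.
Qed.

Fact galg_mul1l : left_id (galg_elt 1%g) galg_mul.
Proof.
move=> f; apply/galgP => z; rewrite galg_mulE (bigD1 1%g) //= galg_eltE eqxx.
rewrite invg1 !mul1g mul1r big1 ?addr0 // => x /negPf x1.
by rewrite galg_eltE x1 mul0r.
Qed.

Fact galg_mul1r : right_id (galg_elt 1%g) galg_mul.
Proof.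
move=> f; apply/galgP => z; rewrite galg_mulE (bigD1 z) //= galg_eltE mulVg.
rewrite eqxx mulr1 big1 ?addr0 // => x /negPf xz.
by rewrite galg_eltE -eq_mulVg1 xz mulr0.
Qed.

Fact galg_mulDl : left_distributive galg_mul +%R.
Proof.
move=> f g h; apply/galgP => z; rewrite galg_addE !galg_mulE -big_split.
by apply: eq_bigr => x _; rewrite galg_addE mulrDl.
Qed.

Fact galg_mulDr : right_distributive galg_mul +%R.
Proof.
move=> f g h; apply/galgP => z; rewrite galg_addE !galg_mulE -big_split.
by apply: eq_bigr => x _; rewrite galg_addE mulrDr.
Qed.

Fact galg_1neq0 : galg_elt 1%g != 0 :> A.
Proof.
apply/eqP => /galgP/(_ 1%g)/eqP.
by rewrite galg_eltE /galg_fun ffunE eqxx oner_eq0.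
Qed.

HB.instance Definition _ := GRing.Zmodule_isNzRing.Build A
  galg_mulA galg_mul1l galg_mul1r galg_mulDl galg_mulDr galg_1neq0.

Fact galg_scaleAl (a : F) f g : a *: (f * g) = (a *: f) * g.
Proof.
apply/galgP => z; rewrite galg_scaleE !galg_mulE mulr_sumr.
by apply: eq_bigr => x _; rewrite galg_scaleE mulrA.
Qed.

HB.instance Definition _ := GRing.Lmodule_isLalgebra.Build F A galg_scaleAl.

Fact galg_scaleAr (a : F) f g : a *: (f * g) = f * (a *: g).
Proof.
apply/galgP => z; rewrite galg_scaleE !galg_mulE mulr_sumr.
by apply: eq_bigr => x _; rewrite galg_scaleE mulrCA.
Qed.

HB.instance Definition _ := GRing.Lalgebra_isAlgebra.Build F A galg_scaleAr.
HB.instance Definition _ := Algebra_isFalgebra.Build F A.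

Lemma galg_eltM x y : galg_elt x * galg_elt y = galg_elt (x * y)%g.
Proof.
apply/galgP => z; rewrite galg_mulE galg_eltE (bigD1 x) //= !galg_eltE eqxx.
rewrite mul1r big1 ?addr0 => [|t /negPf tx]; last by rewrite galg_eltE tx mul0r.
by rewrite -(inj_eq (mulgI x)) mulKVg.
Qed.

End GroupAlgebra.

(* Stable under all automorphisms of R as a ring, not required to fix a base
   field. The short name is taken by the notion for subgroups. *)
Definition ring_characteristic (R : nzRingType) (J : {pred R}) : Prop :=
  forall alpha : {rmorphism R -> R}, bijective alpha ->
  forall y, y \in J <-> exists2 x, x \in J & alpha x = y.

(* In a unital algebra a right ideal is automatically a linear subspace. *)
Definition right_ideal (F : fieldType) (A : falgType F) (J : {vspace A}) : Prop :=
  forall x y : A, x \in J -> x * y \in J.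

Definition codim (F : fieldType) (V : vectType F) (U : {vspace V}) : nat :=
  (\dim {:V} - \dim U)%N.

Section SliceRank.
Variables (F : fieldType) (X Y Z : finType).

Definition slice_decomposable (T : X -> Y -> Z -> F) (r : nat) : Prop :=
  exists a b : nat, (a <= b <= r)%N /\
  exists (f1 : nat -> X -> Y -> F) (g1 : nat -> Z -> F)
         (f2 : nat -> X -> Z -> F) (g2 : nat -> Y -> F)
         (f3 : nat -> Y -> Z -> F) (g3 : nat -> X -> F),
  forall x y z,
    T x y z = \sum_(0 <= i < a) f1 i x y * g1 i z
            + \sum_(a <= i < b) f2 i x z * g2 i y
            + \sum_(b <= i < r) f3 i y z * g3 i x.

Lemma slice_decomposable_ex (T : X -> Y -> Z -> F) :
  exists r, `[< slice_decomposable T r >].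
Proof.
exists #|X|; apply/asboolP; exists 0%N, 0%N; split=> //.
exists (fun _ _ _ => 0), (fun _ _ => 0), (fun _ _ _ => 0), (fun _ _ => 0).
exists (fun i y z => if insub i is Some j then T (enum_val (j : 'I_#|X|)) y z else 0).
exists (fun i x => (i == enum_rank x :> nat)%:R) => x y z.
rewrite !big_nil !add0r big_mkord (bigD1 (enum_rank x)) //= valK enum_rankK eqxx.
rewrite mulr1 big1 ?addr0 // => i /negPf ix.
by rewrite (inj_eq val_inj) ix mulr0.
Qed.

Definition slice_rank (T : X -> Y -> Z -> F) : nat :=
  ex_minn (slice_decomposable_ex T).

End SliceRank.

Definition mul_tensor (F : fieldType) (gT : finGroupType) (x y z : gT) : F :=
  ((x * y)%g == z)%:R.

(* Main.v *)
(* Write F[G] as the direct sum of the F[N] s, for s in a transversal of N.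
   Put A = sum_s I s, B = sum_t J t and C = sum_r (IJ) r. Since J is stable
   under conjugation by G, I s J t = I J s t, and writing s t = n r with n in N
   and using that J is a right ideal, I J n r <= (IJ) r; hence A B <= C.
   Splitting x = a + a' and y = b + b' along complements of A and B gives
   x y = a' y + a b' + a b, whose three terms are sums of codim A, codim B and
   dim C slices respectively. *)

Require Import Defs.
From HB Require Import structures.
From mathcomp Require Import all_boot all_order all_fingroup all_algebra all_field.
From mathcomp Require Import boolp.

Import GRing.Theory.
Local Open Scope ring_scope.

Set Implicit Arguments.
Unset Strict Implicit.
Unset Printing Implicit Defensive.

(** * Bounds on slice rank from subspaces of the group algebra *)

Lemma sum_nat_insub (R : pzSemiRingType) (a k : nat) (u v : 'I_k -> R) :
  \sum_(a <= i < a + k) oapp u 0 (insub (i - a)%N) * oapp v 0 (insub (i - a)%N)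
  = \sum_j u j * v j.
Proof.
rewrite -{1}[a]add0n big_addn addKn big_mkord; apply: eq_bigr => j _.
by rewrite addnK valK.
Qed.

(** Lets each kind of slice be indexed by its own ordinal type, as basis vectors are, rather than by
    consecutive blocks of one range of naturals. *)
Lemma slice_rank_le (F : fieldType) (X Y Z : finType) (T : X -> Y -> Z -> F)
    (p q s : nat)
    (f1 : 'I_p -> X -> Y -> F) (g1 : 'I_p -> Z -> F)
    (f2 : 'I_q -> X -> Z -> F) (g2 : 'I_q -> Y -> F)
    (f3 : 'I_s -> Y -> Z -> F) (g3 : 'I_s -> X -> F) :
    (forall x y z, T x y z = \sum_i f1 i x y * g1 i z
       + \sum_i f2 i x z * g2 i y + \sum_i f3 i y z * g3 i x) ->
  (slice_rank T <= p + q + s)%N.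
Proof.
move=> TE; rewrite /slice_rank; case: ex_minnP => m _; apply.
apply/asboolP; exists p, (p + q)%N; split; first by rewrite !leq_addr.
(* Reindexing from ['I_k] to the block [a <= i < a + k]; the values outside the block never enter
   the sum. *)
pose ext k U V (f : 'I_k -> U -> V -> F) a i x y :=
  oapp (fun j => f j x y) 0 (insub (i - a)%N).
pose ext1 k U (f : 'I_k -> U -> F) a i x :=
  oapp (fun j => f j x) 0 (insub (i - a)%N).
exists (ext _ _ _ f1 0%N), (ext1 _ _ g1 0%N), (ext _ _ _ f2 p), (ext1 _ _ g2 p).
exists (ext _ _ _ f3 (p + q)%N), (ext1 _ _ g3 (p + q)%N) => x y z.
rewrite TE; congr (_ + _ + _); symmetry.
- exact: (sum_nat_insub 0 (fun i => f1 i x y) (fun i => g1 i z)).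
- exact: (sum_nat_insub p (fun i => f2 i x z) (fun i => g2 i y)).
exact: (sum_nat_insub (p + q) (fun i => f3 i y z) (fun i => g3 i x)).
Qed.

Lemma codim_le (F : fieldType) (V : vectType F) (U W : {vspace V}) :
  (U + W)%VS = fullv -> (codim U <= \dim W)%N.
Proof. by move=> UW; rewrite /codim leq_subLR -UW; apply: dimv_add_leqif. Qed.

Lemma mul_tensorE (F : fieldType) (gT : finGroupType) (x y z : gT) :
  mul_tensor F x y z = galg_fun (galg_elt F x * galg_elt F y) z.
Proof. by rewrite galg_eltM galg_eltE /mul_tensor eq_sym. Qed.

Lemma slice_rank_mul_tensor_le (F : fieldType) (gT : finGroupType)
    (A B C : {vspace galg F gT}) :
  (A * B <= C)%VS ->
  (slice_rank (@mul_tensor F gT) <= \dim C + codim B + codim A)%N.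
Proof.
move=> /prodvP ABC; rewrite -[codim A]dimv_compl -[codim B]dimv_compl.
pose e := @galg_elt F gT; pose pA x := projv A (e x); pose pB y := projv B (e y).
(* Expand [pA x * pB y] in a basis of [C], the rest of [e y] in a basis of [B^C] and the rest of
   [e x] in a basis of [A^C]. For [C] the basis vector carries [z] alone; in the other two cases the
   coordinate carries [y] or [x] alone. *)
apply: (slice_rank_le
  (f1 := fun i x y => coord (vbasis C) i (pA x * pB y))
  (g1 := fun i z => galg_fun (vbasis C)`_i z)
  (f2 := fun i x z => galg_fun (pA x * (vbasis B^C)`_i) z)
  (g2 := fun i y => coord (vbasis B^C) i (e y - pB y))
  (f3 := fun i y z => galg_fun ((vbasis A^C)`_i * e y) z)
  (g3 := fun i x => coord (vbasis A^C) i (e x - pA x))) => x y z.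
have galg_funD (f g : galg F gT) : galg_fun (f + g) z = galg_fun f z + galg_fun g z.
  exact: galg_addE.
have galg_fun_sum k (c : 'I_k -> F) (v : 'I_k -> galg F gT) :
    galg_fun (\sum_i c i *: v i) z = \sum_i c i * galg_fun (v i) z.
  rewrite /galg_fun sum_ffunE; apply: eq_bigr => i _; exact: galg_scaleE.
rewrite mul_tensorE -/(e x) -/(e y).
have -> : e x * e y = pA x * pB y + pA x * (e y - pB y) + (e x - pA x) * e y.
  by rewrite mulrBr mulrBl [_ + (pA x * e y - _)]addrC subrK [RHS]addrC subrK.
rewrite !galg_funD; congr (_ + _ + _).
- by rewrite {1}(coord_vbasis (ABC _ _ (memv_proj A _) (memv_proj B _))) galg_fun_sum.
- rewrite {1}(coord_vbasis (memv_projC B (e y))) mulr_sumr.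
  under eq_bigr do rewrite -scalerAr.
  by rewrite galg_fun_sum; apply: eq_bigr => i _; rewrite mulrC.
rewrite {1}(coord_vbasis (memv_projC A (e x))) mulr_suml.
under eq_bigr do rewrite -scalerAl.
by rewrite galg_fun_sum; apply: eq_bigr => i _; rewrite mulrC.
Qed.

Lemma dim_sum_limg (F : fieldType) (aT rT : vectType F) (T : finType)
    (R : {set T}) (f : T -> 'Hom(aT, rT)) (U : {vspace aT}) :
  (\dim (\sum_(r in R) f r @: U)%VS <= #|R| * \dim U)%N.
Proof.
rewrite -sum_nat_const; apply: leq_trans (dimv_leq_sum _ _ _) _.
by apply: leq_sum => r _; rewrite -(limg_ker_dim (f r) U) leq_addl.
Qed.

(** * Linear extension of maps of groups, used for the embedding of F[N] in F[G] and for conjugation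
    on F[N] *)

Definition galg_map (F : fieldType) (gT hT : finGroupType) (phi : gT -> hT)
    (f : galg F gT) : galg F hT :=
  \sum_x galg_fun f x *: galg_elt F (phi x).

Section GroupAlgebraMap.
Variables (F : fieldType) (gT hT : finGroupType) (phi : gT -> hT).

Fact galg_map_is_linear : linear (@galg_map F gT hT phi).
Proof.
move=> a f g; rewrite /galg_map scaler_sumr -big_split; apply: eq_bigr => x _ /=.
by rewrite galg_addE galg_scaleE scalerDl scalerA.
Qed.

HB.instance Definition _ :=
  GRing.isLinear.Build F (galg F gT) (galg F hT) *:%R (@galg_map F gT hT phi)
    galg_map_is_linear.

Lemma galg_map_elt x : galg_map phi (galg_elt F x) = galg_elt F (phi x).
Proof.
rewrite /galg_map (bigD1 x) //= galg_eltE eqxx scale1r big1 ?addr0 // => y /negPf yx.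
by rewrite galg_eltE yx scale0r.
Qed.

Lemma galg_sumE (f : galg F gT) : f = \sum_x galg_fun f x *: galg_elt F x.
Proof.
apply/galgP => z; rewrite /galg_fun sum_ffunE (bigD1 z) //= big1 ?addr0.
  by rewrite !ffunE eqxx /GRing.scale /= mulr1.
by move=> y yz; rewrite !ffunE eq_sym (negPf yz) scaler0.
Qed.

Lemma galg_mapM :
  {morph phi : x y / (x * y)%g} -> {morph @galg_map F gT hT phi : f g / f * g}.
Proof.
move=> phiM f g; rewrite (galg_sumE f) (galg_sumE g) !linear_sum mulr_suml.
rewrite linear_sum mulr_suml; apply: eq_bigr => x _ /=.
rewrite !mulr_sumr linear_sum; apply: eq_bigr => y _ /=.
rewrite !linearZ /= !galg_map_elt -!scalerAl -!scalerAr galg_eltM !linearZ /=.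
by rewrite galg_map_elt phiM galg_eltM !scalerA mulrC.
Qed.

End GroupAlgebraMap.

Lemma galg_map_comp (F : fieldType) (gT hT kT : finGroupType)
    (phi : gT -> hT) (psi : hT -> kT) (f : galg F gT) :
  galg_map psi (galg_map phi f) = galg_map (psi \o phi) f.
Proof.
rewrite [galg_map phi f]/galg_map linear_sum; apply: eq_bigr => x _.
by rewrite linearZ /= galg_map_elt.
Qed.

Lemma galg_map_id (F : fieldType) (gT : finGroupType) (phi : gT -> gT)
    (f : galg F gT) : phi =1 id -> galg_map phi f = f.
Proof.
by move=> phi1; rewrite [RHS]galg_sumE; apply: eq_bigr => x _; rewrite phi1.
Qed.

(** On a finite group an injective endomorphism is an automorphism, so its linear extension is a
    ring automorphism, inverted by the extension of [invF sI]. It will be applied to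
    conjugations. *)
Lemma ring_characteristic_map (F : fieldType) (gT : finGroupType)
    (J : {vspace galg F gT}) (s : gT -> gT) (x : galg F gT) :
  ring_characteristic J -> {morph s : a b / (a * b)%g} -> injective s ->
  x \in J -> galg_map s x \in J.
Proof.
move=> Jchar sM sI Jx.
have map1 : galg_map s 1 = 1 :> galg F gT.
  have s1 : s 1%g = 1%g by apply: (mulgI (s 1%g)); rewrite -sM !mulg1.
  by rewrite -[1]/(galg_elt F 1%g) galg_map_elt s1.
pose alpha : {rmorphism galg F gT -> galg F gT} :=
  HB.pack (@galg_map F gT gT s)
    (GRing.isMonoidMorphism.Build _ _ (@galg_map F gT gT s) (map1, galg_mapM sM)).
have alpha_bij : bijective alpha.
  exists (galg_map (invF sI)) => y; rewrite /= galg_map_comp galg_map_id // => z /=.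
    by rewrite invF_f.
  by rewrite f_invF.
by apply/(Jchar alpha alpha_bij); exists x.
Qed.

(** * Sums of right translates over coset representatives *)

Section CosetSums.
Variables (F : fieldType) (nT kT : finGroupType) (phi : nT -> kT) (R : {set kT}).
Hypothesis phiM : {morph phi : x y / (x * y)%g}.
Hypothesis phiR : forall k, exists n, exists2 r, r \in R & k = (phi n * r)%g.

Definition coset_map (r : kT) : 'Hom(galg F nT, galg F kT) :=
  (amulr (galg_elt F r) \o linfun (@galg_map F nT kT phi))%VF.

Definition coset_sum (U : {vspace galg F nT}) : {vspace galg F kT} :=
  (\sum_(r in R) coset_map r @: U)%VS.

Lemma coset_mapE r f : coset_map r f = galg_map phi f * galg_elt F r.
Proof. by rewrite comp_lfunE !lfunE. Qed.

(** If k = n r with r in [R], then f k = (f n) r lies in U r. The hypothesis ranges over all [n]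
    because this one depends on [k]. *)
Lemma memv_coset_sum (U : {vspace galg F nT}) f k :
  (forall n, f * galg_elt F n \in U) -> galg_map phi f * galg_elt F k \in coset_sum U.
Proof.
move=> fU; have [n [r Rr ->]] := phiR k.
rewrite -galg_eltM mulrA -galg_map_elt -galg_mapM // -coset_mapE.
exact/(subvP (sumv_sup r Rr (subvv _)))/memv_img/fU.
Qed.

Lemma coset_sumD (U W : {vspace galg F nT}) :
  (U + W)%VS = fullv -> (coset_sum U + coset_sum W)%VS = fullv.
Proof.
move=> UW; apply/eqP; rewrite eqEsubv subvf; apply/subvP=> f _.
rewrite [f]galg_sumE; apply: memv_suml => k _; apply: memvZ.
have [n [r Rr ->]] := phiR k.
have /memv_addP [u Uu [w Ww E]] : galg_elt F n \in (U + W)%VS by rewrite UW memvf.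
rewrite -galg_eltM -galg_map_elt -coset_mapE E linearD.
by apply: memv_add; apply/(subvP (sumv_sup r Rr (subvv _)))/memv_img.
Qed.

(** The translates of a complement of [U] span, together with those of [U], the whole algebra, so
    their dimension bounds the codimension. *)
Lemma codim_coset_sum (U : {vspace galg F nT}) :
  (codim (coset_sum U) <= #|R| * codim U)%N.
Proof.
rewrite -[codim U]dimv_compl.
apply: leq_trans (codim_le (coset_sumD (addv_complf U))) _.
exact: dim_sum_limg.
Qed.

(** Stands for n |-> k n k^-1, read back in [nT] through [phi]. *)
Variable conj : kT -> nT -> nT.
Hypothesis conjM : forall k, {morph conj k : x y / (x * y)%g}.
Hypothesis conjI : forall k, injective (conj k).
Hypothesis phi_conj : forall k n, (k * phi n)%g = (phi (conj k n) * k)%g.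

Lemma galg_map_conj k (f : galg F nT) :
  galg_elt F k * galg_map phi f = galg_map phi (galg_map (conj k) f) * galg_elt F k.
Proof.
rewrite galg_map_comp mulr_sumr mulr_suml; apply: eq_bigr => n _.
by rewrite -scalerAr -scalerAl !galg_eltM phi_conj.
Qed.

Lemma prod_coset_sum (I J : {vspace galg F nT}) :
  right_ideal J -> ring_characteristic J ->
  (coset_sum I * coset_sum J <= coset_sum (I * J))%VS.
Proof.
move=> Jright Jchar; apply/prodvP => a b.
case/memv_sumP => u Iu ->; case/memv_sumP => v Jv ->.
rewrite mulr_suml; apply: memv_suml => s Rs.
rewrite mulr_sumr; apply: memv_suml => t Rt.
have /memv_imgP [{u Iu}u Iu ->] := Iu s Rs.
have /memv_imgP [{v Jv}v Jv ->] := Jv t Rt.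
(* Moving s past v gives (u s)(v t) = (u v')(s t), where v' is the conjugate of v by s. *)
rewrite !coset_mapE mulrA -[_ * _ * galg_map phi v]mulrA galg_map_conj mulrA.
rewrite -(galg_mapM phiM) -mulrA galg_eltM; apply: memv_coset_sum => n.
(* The factor n is absorbed by J: v' is in J, hence so is v' n. *)
rewrite -mulrA; apply: memv_mul => //; apply: Jright.
exact: ring_characteristic_map.
Qed.

Lemma slice_rank_coset_sum (I J : {vspace galg F nT}) :
  right_ideal J -> ring_characteristic J ->
  (slice_rank (@mul_tensor F kT) <=
     #|R| * (codim I + codim J + \dim (I * J)))%N.
Proof.
move=> Jright Jchar.
apply: leq_trans (slice_rank_mul_tensor_le (prod_coset_sum I Jright Jchar)) _.
rewrite -addnA addnC [(codim _ + _)%N]addnC !mulnDr !leq_add ?codim_coset_sum //.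
exact: dim_sum_limg.
Qed.

End CosetSums.

Theorem lemma3p21 (F : fieldType) (gT : finGroupType) (G N : {group gT})
    (nNG : (N <| G)%g)
    (I J : {vspace (galg F [subg N])})
    (Jright : right_ideal J) (Jchar : ring_characteristic J) :
  (slice_rank (@mul_tensor F [subg G]) <=
     #|(G / N)%g| * (codim I + codim J + \dim (I * J)))%N.
Proof.
have [sNG nNsG] := andP nNG.
pose phi (n : [subg N]) : [subg G] := subg G (sgval n).
(* Since [x ^ y] is y^-1 x y, the inverse yields k n k^-1. [subg N] returns 1 outside [N], a case
   that normality excludes in [conjN]. *)
pose conj (k : [subg G]) (n : [subg N]) := subg N (sgval n ^ (sgval k)^-1)%g.
pose R := [set subg G (repr C) | C in rcosets N G].
have NG (n : [subg N]) : sgval n \in G by apply: (subsetP sNG); apply: subgP.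
have conjN (k : [subg G]) (n : [subg N]) : (sgval n ^ (sgval k)^-1)%g \in N.
  by rewrite memJ_norm ?subgP // groupV (subsetP nNsG) ?subgP.
have phiM : {morph phi : x y / (x * y)%g}.
  by move=> x y; apply: val_inj; rewrite /= !subgK ?groupM.
have phiR k : exists n, exists2 r, r \in R & k = (phi n * r)%g.
  set C := (N :* sgval k)%g.
  have CR : C \in rcosets N G by rewrite mem_rcosets mulSGid // subgP.
  have /rcosetP [n Nn kE] : sgval k \in (N :* repr C)%g.
    by rewrite rcoset_repr rcoset_refl.
  (* The representative lies in [G] because [n * repr C] is the element [k] of [G] and [n] is in
     [N], hence in [G]. *)
  have CG : repr C \in G.
    by rewrite -(groupMl _ (subsetP sNG _ Nn)) -kE; apply: subgP.
  exists (subg N n), (subg G (repr C)); first exact: imset_f.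
  by apply: val_inj; rewrite /= /phi !subgK // (subsetP sNG).
have conjM k : {morph conj k : x y / (x * y)%g}.
  by move=> x y; apply: val_inj; rewrite /= /conj !(subgK _ (conjN _ _)) -conjMg.
have conjI k : injective (conj k).
  move=> x y /(congr1 val); rewrite /= !subgK // => /conjg_inj; exact: val_inj.
have phi_conj k n : (k * phi n)%g = (phi (conj k n) * k)%g.
  by apply: val_inj; rewrite /= /phi !(subgK _ (NG _)) (subgK _ (conjN _ _)) -conjgCV.
apply: leq_trans (slice_rank_coset_sum phiM phiR conjM conjI phi_conj I Jright Jchar) _.
rewrite leq_mul2r; apply/orP; right.
(* [R] is an image of the set of right cosets, whose size is the index of [N] in [G]. *)
by rewrite card_quotient //; apply: leq_imset_card.
Qed.
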